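(* Let $D=(d_1,d_2,\dots,d_n)$ be a graphic sequence of positive integers in nonincreasing order. The recursive procedure $\mathrm{Gen}$ described in the context, called on $(D,\emptyset,\emptyset)$, outputs every realization of $D$ on the labeled vertex set $\{1,2,\dots,n\}$ exactly once, and outputs nothing else.
   Context: A sequence $D=(d_1,\dots,d_n)$ of positive integers is graphic if there is a simple graph with degree sequence $D$; a realization of $D$ on labeled vertices is a simple graph on $\{1,\dots,n\}$ in which vertex $i$ has degree $d_i$ for every $i$. Integers of a sequence are labeled by their original indices: when values are decreased and the sequence is reordered, the integer with index $i$ keeps its index, its current value is denoted $d_i$, and its current position in the sequence is denoted $p_i$. The 2-reduction $<i,j>$ ($i\neq j$) subtracts 1 from the current values of $d_i$ and $d_j$; $D^{<i,j>}$ is the resulting sequence, reordered in nonincreasing order (ties broken arbitrarily) and with all zeros removed. Edges $(i,j)=(j,i)$ are undirected. Procedure $\mathrm{Gen}(D,X,F)$, where $D$ is the current nonempty nonincreasing labeled sequence, $X$ is a set of edges (already added), and $F$ is a set of edges (forbidden): Let $i$ be the index with $p_i=1$ in $D$, and set $F^+=\emptyset$. For $h=|D|,|D|-1,\dots,d_i+1$, in this decreasing order, do: replace $F$ by $F\cup F^+$; let $j$ be the index with $p_j=h$ in $D$; if $(i,j)\notin X\cup F$, then add $(i,j)$ to $F^+$, set $X'=X\cup\{(i,j)\}$ and $D'=D^{<i,j>}$, and, if $D'$ is nonempty, call $\mathrm{Gen}(D',X',F)$, while if $D'$ is empty, output the graph $(\{1,2,\dots,n\},X')$. All parameters are passed by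 value: $D$ and $X$ are the same at the start of every iteration of the loop, $F^+$ is local to each call, and changes of $F$ inside a recursive call do not affect the calling procedure. *)

(* Defs.v *)
From mathcomp Require Import all_boot.
Set Implicit Arguments.
Unset Strict Implicit.
Unset Printing Implicit Defensive.

(* The vertices 1, ..., n are represented by the ordinals 0, ..., n-1.  The    *)
(* undirected edge (i,j) = (j,i) is the set [set i; j], and a graph on 'I_n is *)
(* given by its set of edges.                                                 *)
Definition edge_set n := {set {set 'I_n}}.

Definition simple_graph n (E : edge_set n) : bool := [forall e in E, #|e| == 2].

Definition degree n (E : edge_set n) (v : 'I_n) : nat :=
  #|[set e in E | v \in e]|.

Definition realization n (D : n.-tuple nat) (E : edge_set n) : bool :=
  simple_graph E && [forall v, degree E v == tnth D v].

Definition graphic n (D : n.-tuple nat) : Prop := exists E, realization D E.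

(* A current sequence lists pairs (original index, current value); the         *)
(* position p_j of index j is 1 plus its rank in the list.                    *)
Definition labeled_seq n := seq ('I_n * nat).

Definition label n (D : n.-tuple nat) : labeled_seq n :=
  [seq (i, tnth D i) | i <- enum 'I_n].

(* S' is a possible value of S^<i,j>: the decreased entries that are nonzero,  *)
(* in some nonincreasing order (each choice of S' is a way of breaking ties). *)
Definition two_reduction n (i j : 'I_n) (S S' : labeled_seq n) : bool :=
  perm_eq S' [seq p <- [seq (p.1, p.2 - (p.1 \in [set i; j])) | p <- S] | 0 < p.2]
  && sorted (fun p q => q.2 <= p.2) S'.

(* A way of computing the 2-reductions, i.e., of breaking ties, that may       *)
(* depend on the sequence, on the sets X and F of the calling procedure (F     *)
(* as of the current iteration) and on i and j.  No generality is lost over    *)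
(* fully arbitrary tie-breaking: distinct 2-reductions in one execution of     *)
(* Gen never have the same X, i and j.                                        *)
Definition reducer n :=
  labeled_seq n -> edge_set n -> edge_set n -> 'I_n -> 'I_n -> labeled_seq n.

Definition reducer_ok n (red : reducer n) : Prop :=
  forall S X F i j, two_reduction i j S (red S X F i j).

(* Big-step semantics.  gen red S X F out: the call Gen(S,X,F), with           *)
(* 2-reductions computed by red, terminates and outputs, in this order, the    *)
(* list of graphs out.  gen_loop red i di S X h F Fp out: the same for the     *)
(* iterations h, h-1, ..., di+1 of the loop of Gen, where i is the first       *)
(* index of S, di its value, and F and Fp are the values of F and F^+ at the   *)
(* start of iteration h.                                                      *)
Inductive gen n (red : reducer n) :
    labeled_seq n -> edge_set n -> edge_set n -> seq (edge_set n) -> Prop :=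
| Gen i di S X F out :
    gen_loop red i di ((i, di) :: S) X (size ((i, di) :: S)) F set0 out ->
    gen red ((i, di) :: S) X F out
with gen_loop n (red : reducer n) :
    'I_n -> nat -> labeled_seq n -> edge_set n ->
    nat -> edge_set n -> edge_set n -> seq (edge_set n) -> Prop :=
| LoopEnd i di S X h F Fp :
    h < di.+1 ->
    gen_loop red i di S X h F Fp [::]
| LoopSkip i di S X h F Fp j dj out :
    di.+1 <= h ->
    onth S h.-1 = Some (j, dj) ->
    [set i; j] \in X :|: (F :|: Fp) ->
    gen_loop red i di S X h.-1 (F :|: Fp) Fp out ->
    gen_loop red i di S X h F Fp out
| LoopCall i di S X h F Fp j dj out1 out2 :
    di.+1 <= h ->
    onth S h.-1 = Some (j, dj) ->
    [set i; j] \notin X :|: (F :|: Fp) ->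
    red S X (F :|: Fp) i j <> [::] ->
    gen red (red S X (F :|: Fp) i j) ([set i; j] |: X) (F :|: Fp) out1 ->
    gen_loop red i di S X h.-1 (F :|: Fp) ([set i; j] |: Fp) out2 ->
    gen_loop red i di S X h F Fp (out1 ++ out2)
| LoopOutput i di S X h F Fp j dj out :
    di.+1 <= h ->
    onth S h.-1 = Some (j, dj) ->
    [set i; j] \notin X :|: (F :|: Fp) ->
    red S X (F :|: Fp) i j = [::] ->
    gen_loop red i di S X h.-1 (F :|: Fp) ([set i; j] |: Fp) out ->
    gen_loop red i di S X h F Fp (([set i; j] |: X) :: out).

(* Main.v *)
Require Import Defs.
From mathcomp Require Import all_boot.
From mathcomp Require Import zify.

(* A graph G can still be output by the call Gen(S,X,F) exactly when it is a
   realization containing X none of whose further edges lies in F; X together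
   with the current values always accounts for all degrees.  Iteration h splits
   these graphs according to whether they contain the edge (i,j): those that do
   are left to the recursive call, those that do not have (i,j) forbidden from
   then on.  After position d_i+1 no graph is left, because the d_i missing
   neighbours of i do not fit in the positions 2, ..., d_i. *)

Set Implicit Arguments.
Unset Strict Implicit.
Unset Printing Implicit Defensive.

(** * Current values as missing degrees *)

(** A sum instead of a lookup: it is total, giving 0 for an index whose entry was removed, and has
    at most one term when the labels are distinct. *)
Definition residue n (S : labeled_seq n) (v : 'I_n) : nat :=
  \sum_(p <- S | p.1 == v) p.2.

Definition residual n (D : n.-tuple nat) (S : labeled_seq n) (X : edge_set n) :=
  [/\ uniq (unzip1 S), all (fun p => 0 < p.2) S, simple_graph X
    & forall v, degree X v + residue S v = tnth D v].

(** The last condition forbids only edges of [G] outside [X], so disjointness of [X] and [F] need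
    not be carried along. *)
Definition completes n (D : n.-tuple nat) (X F G : edge_set n) : bool :=
  [&& realization D G, X \subset G & G :&: F \subset X].

Lemma residue_gt0_mem n (S : labeled_seq n) v :
  0 < residue S v -> v \in unzip1 S.
Proof.
rewrite lt0n; apply: contraNT => vS; apply/eqP; apply: big1_seq => p.
by case/andP => /eqP pv pS; move: vS; rewrite -pv map_f.
Qed.

Lemma residue_notin n (S : labeled_seq n) v :
  v \notin unzip1 S -> residue S v = 0.
Proof. by move=> vS; apply/eqP; rewrite -leqn0 leqNgt (contra (@residue_gt0_mem _ S v)). Qed.

Lemma residue_cons n (S : labeled_seq n) p v :
  residue (p :: S) v = (p.1 == v) * p.2 + residue S v.
Proof. by rewrite /residue big_cons; case: eqP; rewrite ?mul1n ?mul0n. Qed.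

Lemma residue_two_reduction n (S S' : labeled_seq n) i j v :
    two_reduction i j S S' -> uniq (unzip1 S) ->
  residue S' v = residue S v - (v \in [set i; j]).
Proof.
case/andP => perm _ uniqS; rewrite /residue (perm_big _ perm) big_filter_cond /=.
rewrite big_map /= {perm}; elim: S uniqS => [|p S IH] /=; first by rewrite !big_nil.
case/andP => pS /IH; rewrite !big_cons /=; case: (p.1 =P v) => [<-|_] /=; last by rewrite andbF.
(* The labels are distinct, so once the head carries this label the tail contributes nothing. *)
move=> ->; have -> : \sum_(q <- S | q.1 == p.1) q.2 = 0 by apply: residue_notin.
by rewrite andbT sub0n !addn0; case: posnP.
Qed.

Lemma two_reduction_unzip1_uniq n (S S' : labeled_seq n) i j :
  two_reduction i j S S' -> uniq (unzip1 S) -> uniq (unzip1 S').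
Proof.
case/andP => perm _ uniqS; rewrite (perm_uniq (perm_map _ perm)).
rewrite (subseq_uniq (map_subseq _ (filter_subseq _ _))) //.
by rewrite /unzip1 -map_comp (eq_map (g := fst)).
Qed.

Lemma two_reduction_gt0 n (S S' : labeled_seq n) i j :
  two_reduction i j S S' -> all (fun p => 0 < p.2) S'.
Proof. by case/andP => perm _; rewrite (perm_all _ perm) filter_all. Qed.

Lemma residue_gt0 n (S : labeled_seq n) v :
  all (fun p => 0 < p.2) S -> v \in unzip1 S -> 0 < residue S v.
Proof.
move=> pos /mapP[p pS ->]; rewrite lt0n /residue sum_nat_seq_neq0.
by apply/hasP; exists p; rewrite // eqxx -lt0n (allP pos).
Qed.

Lemma degree_setU1 n (X : edge_set n) e v :
  e \notin X -> degree (e |: X) v = (v \in e) + degree X v.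
Proof.
move=> eX; rewrite /degree; case: (boolP (v \in e)) => ve.
  have -> : [set f in e |: X | v \in f] = e |: [set f in X | v \in f].
    by apply/setP => f; rewrite !inE; case: eqP => // ->; rewrite ve.
  by rewrite cardsU1 inE (negPf eX).
apply: eq_card => f; rewrite !inE; case: eqP => [->|]; rewrite ?(negPf ve) ?andbF //.
Qed.

Lemma residual_two_reduction n (D : n.-tuple nat) S S' X i j :
    residual D S X -> i \in unzip1 S -> j \in unzip1 S -> i != j ->
    [set i; j] \notin X -> two_reduction i j S S' ->
  residual D S' ([set i; j] |: X).
Proof.
case=> uniqS pos sX deg iS jS ij eX red.
split; first exact: two_reduction_unzip1_uniq red uniqS.
- exact: two_reduction_gt0 red.
- apply/forall_inP => e; rewrite !inE => /orP[/eqP->|]; first by rewrite cards2 ij.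
  by move/forall_inP: sX; apply.
move=> v; rewrite degree_setU1 // (residue_two_reduction _ red) // -deg.
(* Entries of [S] are positive, so the truncated subtraction at [i] and [j] is exact and cancels the
   gain in degree. *)
suff: (v \in [set i; j]) <= residue S v by move: (nat_of_bool (v \in _)) => b; lia.
by case: (boolP (v \in _)) => //; rewrite !inE => /orP[]/eqP->; rewrite residue_gt0.
Qed.

(** * Realizations still reachable from a call *)

Lemma degree_setD n (X G : edge_set n) v :
  X \subset G -> degree G v = degree X v + degree (G :\: X) v.
Proof.
move=> XG; rewrite /degree -(cardsID X [set e in G | v \in e]); congr (_ + _).
  by apply: eq_card => e; rewrite !inE; case: (boolP (e \in X)) => [/(subsetP XG)->|];
    rewrite ?andbT ?andbF.
by apply: eq_card => e; rewrite !inE andbA.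
Qed.

Lemma completes_new_degree n (D : n.-tuple nat) S X F G v :
    residual D S X -> completes D X F G -> degree (G :\: X) v = residue S v.
Proof.
case=> _ _ _ deg /and3P[/andP[_ /forallP/(_ v)/eqP]].
by rewrite -deg => + XG _; rewrite (degree_setD _ XG) => /addnI.
Qed.

(** An edge of [G] outside [X] would have an endpoint with a missing degree, but an empty sequence
    leaves none. *)
Lemma completes_nil n (D : n.-tuple nat) X F G :
  residual D [::] X -> completes D X F G = (X == G).
Proof.
move=> resX; apply/idP/eqP => [cG | <-].
  have /and3P[/andP[/forall_inP sG _] XG _] := cG; apply/eqP; rewrite eqEsubset XG.
  apply/subsetP => e eG; apply: contraT => eX.
  have /card_gt0P[v ve] : 0 < #|e| by rewrite (eqP (sG _ eG)).
  have := completes_new_degree v resX cG; rewrite /residue big_nil => /eqP.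
  by rewrite cards_eq0 => /eqP/setP/(_ e); rewrite !inE eG eX ve.
case: resX => _ _ sX deg; rewrite /completes subxx subsetIl !andbT /realization sX.
by apply/forallP => v; apply/eqP; rewrite -deg /residue big_nil addn0.
Qed.

(** Graphs containing [e] count in the first term, those avoiding it in the second. The truth values
    are added in [nat] to match the counts in concatenated outputs. *)
Lemma completes_split n (D : n.-tuple nat) X F e G :
    e \notin X :|: F ->
  completes D X F G = completes D (e |: X) F G + completes D X (e |: F) G :> nat.
Proof.
rewrite inE negb_or => /andP[eX eF]; rewrite /completes.
case: realization => //=; rewrite subUset sub1set setIUr subUset.
case: (boolP (X \subset G)) => XG; rewrite ?andbF //= andbT.
case: (boolP (e \in G)) => eG /=.
  have -> : (G :&: [set e] \subset X) = false.
    by apply: contraNF eX => /subsetP; apply; rewrite !inE eG eqxx.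
  rewrite addn0; congr nat_of_bool; apply/idP/idP => /subsetP sub.
    by apply/subsetP => f /sub fX; rewrite inE fX orbT.
  apply/subsetP => f fGF; have /setU1P[fe|//] := sub _ fGF.
  by move: fGF; rewrite fe inE (negPf eF) andbF.
rewrite add0n; have -> : G :&: [set e] = set0; last by rewrite sub0set.
by apply/setP => f; rewrite !inE; case: eqP => [->|]; rewrite ?andbF // andbT (negPf eG).
Qed.

Lemma completes_exhausted n (D : n.-tuple nat) i di S X F h G :
    residual D ((i, di) :: S) X -> h < di.+1 ->
    (forall k j dj, h <= k -> onth ((i, di) :: S) k = Some (j, dj) ->
       [set i; j] \in X :|: F) ->
  completes D X F G = false.
Proof.
move=> res hdi done_h; apply/negP => cG.
have := completes_new_degree i res cG.
have [/= /andP[iS _] /andP[/= di0 _] _ _] := res.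
rewrite residue_cons eqxx mul1n residue_notin // addn0 /= => degi.
have /and3P[/andP[/forall_inP sG _] XG GF] := cG.
(* This degree equals [di], and [h.-1 < di] also when [h = 0], because [di] is positive. *)
suff: degree (G :\: X) i <= h.-1 by lia.
(* Candidate new edges at [i]: its partners can only be the entries of the whole sequence before
   index [h], without the head [i]. *)
set s := [seq [set i; p.1] | p <- take h.-1 S].
have: size s <= h.-1 by rewrite size_map size_take_min geq_minl.
apply: leq_trans; apply: leq_trans (card_size s).
apply/subset_leq_card/subsetP => e; rewrite !inE -andbA => /and3P[eX eG ie].
have /cards2P[a [b [ab eab]]] := sG e eG.
have [j ij eij] : exists2 j, i != j & e = [set i; j].
  move: ie; rewrite eab !inE => /orP[]/eqP->; first by exists b.
  by exists a; rewrite 1?eq_sym // setUC.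
(* The other end of a new edge still misses a degree, so it is still listed. *)
have: j \in unzip1 ((i, di) :: S).
  apply: residue_gt0_mem; rewrite -(completes_new_degree j res cG) card_gt0.
  by apply/set0Pn; exists e; rewrite !inE eX eG eij !inE eqxx orbT.
rewrite inE eq_sym (negPf ij) /= => /mapP[p pS jp].
have [k pk] := onthP pS; case: (ltnP k h.-1) => hk.
  by apply/mapP; exists p; rewrite -?jp //; apply/onthP; exists k;
    rewrite onthE map_take nth_take -?onthE.
have: [set i; j] \in X :|: F.
  (* Index [k] in the tail [S] is index [k.+1] in the whole sequence. *)
  by apply: (done_h k.+1 j p.2); [lia | rewrite jp /= pk -surjective_pairing].
rewrite -eij inE (negPf eX) /= => eF.
by move/subsetP/(_ e): GF; rewrite inE eG eF (negPf eX) => /(_ isT).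
Qed.

(** * Loop invariant and output counts *)

Lemma onth_neq_head n (S : labeled_seq n) i di j dj k :
    ohead S = Some (i, di) -> uniq (unzip1 S) -> 0 < k ->
    onth S k = Some (j, dj) ->
  i != j.
Proof.
case: S => // p S [->] /= /andP[iS _]; case: k => // k _ /= kS.
apply: contraNneq iS => ->; apply/mapP; exists (j, dj) => //.
by apply/onthP; exists k.
Qed.

Lemma onth_unzip1 n (S : labeled_seq n) j dj k :
  onth S k = Some (j, dj) -> j \in unzip1 S.
Proof. by move=> kS; apply/mapP; exists (j, dj) => //; apply/onthP; exists k. Qed.

(** Maintains the loop invariant that every edge from [i] to an entry at index [h] or later is
    already added or forbidden. *)
Lemma exhausted_pred n (S : labeled_seq n) (i : 'I_n) (E E' : edge_set n) h j dj :
    0 < h -> onth S h.-1 = Some (j, dj) -> E \subset E' -> [set i; j] \in E' ->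
    (forall k l dl, h <= k -> onth S k = Some (l, dl) -> [set i; l] \in E) ->
  forall k l dl, h.-1 <= k -> onth S k = Some (l, dl) -> [set i; l] \in E'.
Proof.
move=> h0 hS EE' jE' done_h k l dl; rewrite leq_eqVlt prednK //.
case/orP => [/eqP<-|hk kS]; first by rewrite hS => -[<-].
exact: subsetP EE' _ (done_h _ _ _ hk kS).
Qed.

Scheme gen_min := Minimality for gen Sort Prop
  with gen_loop_min := Minimality for gen_loop Sort Prop.
Combined Scheme gen_mutind from gen_min, gen_loop_min.

Lemma residual_step n (D : n.-tuple nat) (red : reducer n) S X F i di j dj h :
    reducer_ok red -> residual D S X -> ohead S = Some (i, di) -> di < h ->
    onth S h.-1 = Some (j, dj) -> [set i; j] \notin X :|: F ->
  residual D (red S X F i j) ([set i; j] |: X).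
Proof.
move=> red_ok res hd hdi hS; rewrite inE negb_or => /andP[eX _].
have [uniqS pos _ _] := res.
have iS : i \in unzip1 S by case: S hd {res hS uniqS pos} => //= p S [->]; exact: mem_head.
have di0 : 0 < di by case: S hd pos {res hS uniqS iS} => //= p S [->] /andP[].
apply: residual_two_reduction res iS (onth_unzip1 hS) _ eX (red_ok S X F i j).
(* From [0 < di < h] the index [h.-1] is positive: the loop stops before reaching [i] itself. *)
by apply: onth_neq_head hd uniqS _ hS; lia.
Qed.

(** Multiplicities capture both claims at once: 1 for a reachable graph, 0 for any other. The loop
    statement uses [F :|: Fp], the value of [F] after the update that opens the iteration. *)
Lemma gen_count n (D : n.-tuple nat) (red : reducer n) :
    reducer_ok red ->
  (forall S X F out, gen red S X F out -> residual D S X ->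
     forall G, count_mem G out = completes D X F G) /\
  (forall i di S X h F Fp out, gen_loop red i di S X h F Fp out ->
     residual D S X -> ohead S = Some (i, di) ->
     (forall k j dj, h <= k -> onth S k = Some (j, dj) ->
        [set i; j] \in X :|: (F :|: Fp)) ->
     forall G, count_mem G out = completes D X (F :|: Fp) G).
Proof.
move=> red_ok; apply: gen_mutind.
(* The loop starts at [size S], where no entry lies at index [h] or later, so the invariant is
   vacuous. *)
- move=> i di S X F out _ IH res G; rewrite IH ?setU0 // => k j dj hk kS.
  by move: (onthTE ((i, di) :: S) k); rewrite kS ltnNge hk.
- move=> i di [//|p S] X h F Fp hdi res [pE] done_h G; rewrite {}pE in res done_h.
  by rewrite (completes_exhausted G res hdi done_h).
- move=> i di S X h F Fp j dj out hdi hS eXF _ IH res hd done_h G.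
  rewrite IH -?setUA ?setUid //.
  by apply: exhausted_pred done_h; first exact: leq_trans hdi; eauto.
- move=> i di S X h F Fp j dj out1 out2 hdi hS eXF _ _ IH1 _ IH2 res hd done_h G.
  rewrite count_cat (completes_split D G eXF) IH1; last exact: residual_step hdi hS eXF.
  (* The recursive call does not yet forbid the edge [(i,j)]; the remaining iterations do. *)
  have FE : F :|: Fp :|: ([set i; j] |: Fp) = [set i; j] |: (F :|: Fp).
    by rewrite setUCA -setUA setUid.
  rewrite -FE IH2 //.
  apply: exhausted_pred done_h; [exact: leq_trans hdi | exact: hS | | ].
    by rewrite setUS ?subsetUl.
  by rewrite !(inE, eqxx, orbT).
move=> i di S X h F Fp j dj out hdi hS eXF redE _ IH res hd done_h G.
(* An empty reduction leaves no missing degree, so the output graph is the only one containing [X]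
   and the new edge that is reachable. *)
have res' := residual_step red_ok res hd hdi hS eXF. rewrite redE in res'.
rewrite /= (completes_split D G eXF) (completes_nil _ _ res').
have FE : F :|: Fp :|: ([set i; j] |: Fp) = [set i; j] |: (F :|: Fp).
  by rewrite setUCA -setUA setUid.
rewrite -FE IH //.
apply: exhausted_pred done_h; [exact: leq_trans hdi | exact: hS | | ].
  by rewrite setUS ?subsetUl.
by rewrite !(inE, eqxx, orbT).
Qed.

(** * Termination *)

(** Outer induction on the number of vertex sets outside [X], which drops at each recursive call
    since the added edge is new; inner induction on the loop counter. *)
Lemma gen_total n (red : reducer n) S X F :
  S <> [::] -> exists out, gen red S X F out.
Proof.
have [m] := ubnP #|~: X|; elim: m S X F => // m IHm S X F Xm S0.
suff loop i di h Fl Fp : h <= size S -> exists out, gen_loop red i di S X h Fl Fp out.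
  case: S S0 loop => // -[i di] S _ loop.
  by have [out] := loop i di (size ((i, di) :: S)) F set0 (leqnn _); exists out; constructor.
elim: h Fl Fp => [|h IHh] Fl Fp hS; first by exists [::]; constructor.
have [hdi|hdi] := ltnP h.+1 di.+1; first by exists [::]; constructor.
case kS: (onth S h) => [[j dj]|]; last by move: (onthTE S h); rewrite kS hS.
case: (boolP ([set i; j] \in X :|: (Fl :|: Fp))) => eXF.
  have [out ?] := IHh (Fl :|: Fp) Fp (ltnW hS).
  by exists out; exact: (LoopSkip hdi kS eXF _).
have [out2 loop2] := IHh (Fl :|: Fp) ([set i; j] |: Fp) (ltnW hS).
have [redE|/eqP red0] := eqVneq (red S X (Fl :|: Fp) i j) [::].
  by exists (([set i; j] |: X) :: out2); exact: (LoopOutput hdi kS eXF redE _).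
have [|out1 gen1] := IHm (red S X (Fl :|: Fp) i j) ([set i; j] |: X) (Fl :|: Fp) _ red0.
  rewrite -ltnS; apply: leq_trans Xm; rewrite ltnS; apply: proper_card.
  rewrite properC; apply/properP; split; first exact: subsetUr.
  exists [set i; j]; first by rewrite !inE eqxx.
  by move: eXF; rewrite inE negb_or => /andP[].
by exists (out1 ++ out2); exact: (LoopCall hdi kS eXF red0 gen1 loop2).
Qed.

(** * The initial call *)

Lemma unzip1_label n (D : n.-tuple nat) : unzip1 (label D) = enum 'I_n.
Proof. by rewrite /unzip1 /label -map_comp (eq_map (g := id)) ?map_id. Qed.

Lemma residual_label n (D : n.-tuple nat) :
  (forall i, 0 < tnth D i) -> residual D (label D) set0.
Proof.
move=> D_pos; split; first by rewrite unzip1_label enum_uniq.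
- by rewrite all_map; apply/allP => i _ /=.
- by apply/forall_inP => e; rewrite inE.
move=> v; rewrite /residue big_map big_enum_cond /= (big_pred1 v) //.
by rewrite /degree eq_card0 // => e; rewrite !inE.
Qed.

Theorem claim3p4 (n : nat) (D : n.-tuple nat) (red : reducer n)
    (n_gt0 : 0 < n)
    (D_pos : forall i : 'I_n, 0 < tnth D i)
    (D_noninc : sorted geq D)
    (D_graphic : graphic D)
    (red_ok : reducer_ok red) :
  (exists out : seq (edge_set n), gen red (label D) set0 set0 out) /\
  (forall out : seq (edge_set n), gen red (label D) set0 set0 out ->
     (forall G : edge_set n, realization D G -> count_mem G out = 1) /\
     (forall G : edge_set n, G \in out -> realization D G)).
Proof.
split.
  apply: gen_total => /(congr1 size); rewrite size_map size_enum_ord.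
  by case: n n_gt0 {D red D_pos D_noninc D_graphic red_ok}.
move=> out gen_out; have [gen_cnt _] := gen_count D red_ok.
(* With [X] and [F] empty, nothing is prescribed or forbidden. *)
have cnt G : count_mem G out = realization D G.
  by rewrite (gen_cnt _ _ _ _ gen_out (residual_label D_pos)) /completes setI0 !sub0set !andbT.
split=> G; first by rewrite cnt => ->.
by rewrite -has_pred1 has_count cnt lt0b.
Qed.
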